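(* Assume $2^{<\mathfrak{c}} = \mathfrak{c}$. Let $X$ be a Lindelöf Hausdorff space such that $\hat{F}(X) \cdot g(X) \leq \mathfrak{c}$. Then $|X| \leq \mathfrak{c}$.
   Context: All spaces are Hausdorff. $\mathfrak{c} = 2^{\aleph_0}$ and $2^{<\mathfrak{c}} = \sup\{2^\lambda : \lambda < \mathfrak{c}\}$. A subset of $X$ is discrete if its subspace topology is discrete (it need not be closed). A sequence $\{x_\alpha : \alpha < \kappa\}$ of points of $X$ ($\kappa$ an ordinal) is free if for every $\gamma < \kappa$ we have $\overline{\{x_\alpha : \alpha \leq \gamma\}} \cap \overline{\{x_\alpha : \alpha > \gamma\}} = \emptyset$; a subset of $X$ is called a free sequence if it can be enumerated as one. $\hat{F}(X) = \min\{\kappa : \text{if } A \subset X \text{ and } |A| = \kappa \text{ then } A \text{ is not a free sequence}\}$. $g(X) = \sup\{|\overline{D}| : D \subset X \text{ is discrete}\}$. *)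

(* Defs.v *)
From mathcomp Require Import all_boot all_classical all_analysis.
From mathcomp Require Import wochoice.

Set Implicit Arguments.
Unset Strict Implicit.
Unset Printing Implicit Defensive.

Local Open Scope classical_set_scope.
Local Open Scope card_scope.

(* Cardinals are represented by types, taken up to equipotence: every notion
   below depends on a cardinal only through [#<=] and [#=].  Naming [Type] once
   makes all of them range over one and the same universe.  The cardinal of a
   set [A] is the type [set_type A]. *)
Definition cardinal := Type.

Definition cle (K L : cardinal) : Prop := [set: K] #<= [set: L].

Definition clt (K L : cardinal) : Prop := cle K L /\ ~ cle L K.

Definition cmul (K L : cardinal) : cardinal := (K * L)%type.

(* 2 ^ K, as the cardinal of a powerset *)
Definition cexp2 (K : cardinal) : cardinal := set K.

Definition continuum : cardinal := cexp2 nat.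

Definition is_csup (P : cardinal -> Prop) (K : cardinal) : Prop :=
  (forall L, P L -> cle L K) /\
  (forall M, (forall L, P L -> cle L M) -> cle K M).

Definition is_cmin (P : cardinal -> Prop) (K : cardinal) : Prop :=
  P K /\ forall L, P L -> cle K L.

(* [L] is 2 ^ (< K) *)
Definition is_cexp2_lt (K L : cardinal) : Prop :=
  is_csup (fun M => exists2 J, clt J K & M = cexp2 J) L.

Definition lindelof (X : topologicalType) : Prop :=
  forall C : set (set X), C `<=` open -> \bigcup_(U in C) U = [set: X] ->
  exists D : set (set X),
    [/\ D `<=` C, countable D & \bigcup_(U in D) U = [set: X]].

(* [set_type A], the coercion of [A] to a type, carries the subspace
   topology. *)
Definition discrete_subset (X : topologicalType) (A : set X) : Prop :=
  forall B : set (set_type A), open B.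

(* The ordinal indexing the sequence is given as a type [I] with a (reflexive)
   well-order [R], so that [R a c] reads a <= c and [~~ R a c] reads c < a.
   Its length is any ordinal, and injectivity of [x] follows from freeness. *)
Definition free_sequence (X : topologicalType) (I : Type) (R : rel I)
    (x : I -> X) : Prop :=
  forall c : I,
    closure (x @` [set a | R a c]) `&` closure (x @` [set a | ~~ R a c]) = set0.

Definition is_free_sequence (X : topologicalType) (A : set X) : Prop :=
  exists (I : cardinal) (R : rel I) (x : I -> X),
    [/\ well_order R, free_sequence R x & range x = A].

(* [K] is \hat{F}(X) *)
Definition is_Fhat (X : topologicalType) (K : cardinal) : Prop :=
  is_cmin (fun L => forall A : set X, A #= [set: L] -> ~ is_free_sequence A) K.

(* [K] is g(X) *)
Definition is_g (X : topologicalType) (K : cardinal) : Prop :=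
  is_csup (fun L => exists2 D : set X,
    discrete_subset D & L = set_type (closure D)) K.

(* Main.v *)
Require Import Defs.
From mathcomp Require Import all_boot all_classical all_analysis.
From mathcomp Require Import wochoice.

(** Write c for the continuum.  The bound on g says that discrete sets have
closures of size at most c, and the bound on the free-sequence number says that
no free sequence has length c.  Two separation facts follow.

- Each point x is separated from all other points by c open neighbourhoods
  ([point_separated]).  Choose around every z <> x an open set whose closure
  misses x; a transfinite selection ([discrete_almost_covering])
  yields a discrete D such that the sets chosen at the points of the closure of D already
  cover the complement of x, and that closure has size at most c.
- Hence each closed K of size at most c is separated from all points outside it
  by c open supersets ([closed_separated]): by the Lindelof property, countably
  many of the neighbourhoods above cover K, and c has only c countable families.

Now index by a well-order of c all of whose proper initial segments are smaller
than c.  For a point p, build a sequence x_i: let S_i be the set of earlier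
terms, let W_i be one of the c open sets separating the closure of S_i from p,
and let x_i be a point, chosen as a function of the union alone, outside the
union of all W_j with j <= i.  The points x_i exist because p itself lies
outside every W_j.  As long as p has not entered the closure of some S_j, the
terms form a discrete free sequence, so the closure of S_i has size at most c
and the construction goes on.  It cannot last c steps, since that would give a
free sequence of length c.  So p lies in the closure of S_i for some i.

The sequence below i is determined by the choices of the W_j with j < i, made
among c possibilities each.  Hence p is determined by i, by fewer than c choices
out of c, and by its place in a closure of size at most c.  There are at most
c many such data, because c to the power J is at most c for each J < c: it is 2
to the power (nat * J), the hypothesis on powers of 2 applies to nat * J, and
nat * J < c by Konig's diagonal argument ([konig_continuum]).  The
counting is done in [cle_continuum_of_separated]. *)

Set Implicit Arguments.
Unset Strict Implicit.
Unset Printing Implicit Defensive.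

Local Open Scope classical_set_scope.
Local Open Scope card_scope.

(** * Cardinal arithmetic below the continuum *)

Lemma inj_on_card_le T U (A : set T) (f : T -> U) :
  (forall x y, A x -> A y -> f x = f y -> x = y) -> A #<= [set: U].
Proof.
move=> finj; apply: (@card_le_trans _ _ _ (f @` A)); last exact: card_leT.
have := @inj_card_eq _ _ A f; rewrite card_eq_le => /(_ _)/andP[]// x y.
by rewrite !inE; apply: finj.
Qed.

Lemma cleP (K L : cardinal) : cle K L <-> exists f : K -> L, injective f.
Proof.
split=> [/card_leP[f]|[f finj]].
  exists (fun x => val (f (SigSub (mem_set (I : [set: K] x))))) => x y /val_inj.
  by move=> /(@inj _ _ _ f); rewrite !inE => /(_ I I) [].
by apply: (inj_on_card_le (f := f)) => x y _ _; apply: finj.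
Qed.

Lemma cle_trans (K L M : cardinal) : cle K L -> cle L M -> cle K M.
Proof. exact: card_le_trans. Qed.

Lemma card_le_continuumP T (A : set T) :
  A #<= [set: continuum] <->
  exists f : T -> continuum, forall x y, A x -> A y -> f x = f y -> x = y.
Proof.
split=> [/pcard_leTP[f]|[f finj]].
  by exists f => x y Ax Ay /(@inj _ _ _ f); apply; rewrite inE.
exact: inj_on_card_le finj.
Qed.

(** 2 ^ nat raised to the power nat is 2 ^ (nat * nat). *)
Lemma cle_fun_continuum : cle (nat -> continuum) continuum.
Proof.
apply/cleP.
exists (fun f => [set m : nat | exists2 p : nat * nat, m = pickle p & f p.1 p.2]).
move=> f g /seteqP[fg gf]; apply/funext => n; apply/seteqP; split=> k fnk.
  have [|[n' k'] /(pcan_inj pickleK)[<- <-] //] := fg (pickle (n, k)).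
  by exists (n, k).
have [|[n' k'] /(pcan_inj pickleK)[<- <-] //] := gf (pickle (n, k)).
by exists (n, k).
Qed.

Lemma cle_mul_continuum : cle (cmul continuum continuum) continuum.
Proof.
apply: cle_trans cle_fun_continuum; apply/cleP.
exists (fun p n => if n is 0 then p.1 else p.2) => -[a b] [c d] /= e.
by have := congr1 (@^~ 0) e; have := congr1 (@^~ 1) e => /= -> ->.
Qed.

(** Konig's diagonalization: given an injection of the functions from [nat] to
the continuum into [nat * J], the values at [n] of the functions sent to row [n]
number at most [J], so some value is missed; a function that takes a missed
value at each [n] has no row. *)
Lemma konig_continuum (J : cardinal) :
  ~ cle continuum J -> ~ cle continuum (nat * J)%type.
Proof.
move=> nJ /cleP[f finj]; have /cleP[e einj] := cle_fun_continuum.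
have /choice[h hP] : forall n, exists c, forall (s : J) (h : nat -> continuum),
    f (e h) = (n, s) -> h n <> c.
  move=> n; apply: contrapT => /forallNP nc; apply: nJ.
  have /choice[s sP] : forall c, exists s : J, exists2 h : nat -> continuum,
      f (e h) = (n, s) & h n = c.
    move=> c; have /existsNP[s /existsNP[h /not_implyP[fs /contrapT hc]]] := nc c.
    by exists s, h.
  apply/cleP; exists s => c d sE.
  have [h1 fh1 <-] := sP c; have [h2 fh2 <-] := sP d.
  by rewrite sE -fh2 in fh1; rewrite (einj _ _ (finj _ _ fh1)).
by case fE: (f (e h)) => [n s]; apply: (hP n s h).
Qed.

Lemma cle_pow_continuum (J : cardinal) : is_cexp2_lt continuum continuum ->
  clt J continuum -> cle (J -> continuum) continuum.
Proof.
move=> [pow_le _] [/cleP[f finj] nJ].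
have : cle (cexp2 (nat * J)%type) continuum.
  apply: pow_le; exists (nat * J)%type => //; split; last exact: konig_continuum.
  apply: cle_trans cle_mul_continuum; apply/cleP.
  exists (fun p => ([set p.1], f p.2)) => -[n s] [m t] /= [nm /finj ->].
  suff -> : n = m by [].
  by have : [set n] n by []; rewrite nm.
apply: cle_trans; apply/cleP.
exists (fun s p => s p.2 p.1) => s t st; apply/funext => j; apply/funext => n.
exact: (congr1 (@^~ (n, j)) st).
Qed.

(** * Recursion and well-orders *)

(** Well-founded recursion for total functions: instead of a dependently typed
functional on values below [i], [Phi] takes a whole function and only has to
ignore its values elsewhere. *)
Lemma exists_recursive (I T : Type) (lt : I -> I -> Prop) (t0 : T)
    (Phi : I -> (I -> T) -> T) :
  well_founded lt ->
  (forall i f g, (forall j, lt j i -> f j = g j) -> Phi i f = Phi i g) ->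
  exists f : I -> T, forall i, f i = Phi i f.
Proof.
move=> wf causal.
pose extend i (f : forall j, lt j i -> T) j :=
  if pselect (lt j i) is left ltji then f j ltji else t0.
pose F i f := Phi i (@extend i f).
exists (Fix wf (fun=> T) F) => i; rewrite Fix_eq.
  apply: causal => j ltji; rewrite /extend; by case: pselect.
move=> {}i f g fg; apply: causal => j ltji; rewrite /extend.
by case: pselect.
Qed.

(** A point of [below R i] is strictly less than [i], [R] being reflexive. *)
Definition below I (R : rel I) (i : I) : set I := [set j | ~~ R i j].

Section WellOrder.
Variables (I : Type) (R : rel I).
Hypothesis woR : well_order R.

Lemma wo_min (P : set I) : P !=set0 -> exists2 z, P z & forall x, P x -> R z x.
Proof.
move=> [x Px]; have [|z [[Pz zP] _]] := @woR (fun x => `[< P x >]).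
  by exists x; apply/asboolP.
by exists z => [|y Py]; [exact/asboolP | apply: zP; apply/asboolP].
Qed.

Lemma wo_refl x : R x x.
Proof. by have [|z -> ->] := @wo_min [set x]; first by exists x. Qed.

Lemma wo_total x y : R x y \/ R y x.
Proof.
have [|z [->|->] zP] := @wo_min [set x; y]; first by exists x; left.
- by left; apply: zP; right.
- by right; apply: zP; left.
Qed.

Lemma wo_anti x y : R x y -> R y x -> x = y.
Proof.
move=> xy yx; have [|z [_ zU]] := @woR (fun u => `[< u = x \/ u = y >]).
  by exists x; apply/asboolP; left.
rewrite -(zU x) ?(zU y)//; split; try by apply/asboolP; auto.
  by move=> u /asboolP[]->//; apply: wo_refl.
by move=> u /asboolP[]->//; apply: wo_refl.
Qed.

Lemma wo_trans y x z : R x y -> R y z -> R x z.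
Proof.
move=> xy yz; have [|m mP mmin] := @wo_min [set u | [\/ u = x, u = y | u = z]].
  by exists x; constructor.
case: mP => mE; first by rewrite -mE; apply: mmin; constructor.
- have yx : R y x by rewrite -mE; apply: mmin; constructor.
  by rewrite (wo_anti xy yx).
- have zy : R z y by rewrite -mE; apply: mmin; constructor.
  by rewrite -(wo_anti yz zy).
Qed.

Lemma belowW j i : below R i j -> R j i.
Proof. by rewrite /below/= => /negP nij; case: (wo_total i j). Qed.

Lemma below_trans k j i : R k j -> below R i j -> below R i k.
Proof. by move=> kj /negP nij; apply/negP => ik; apply: nij; apply: wo_trans kj. Qed.

Lemma subset_below j i : R j i -> below R j `<=` below R i.
Proof. by move=> ji k /negP kj; apply/negP => /(wo_trans ji). Qed.

Lemma wo_wf : well_founded (fun j i => below R i j).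
Proof.
move=> i; apply: contrapT => ni.
have [|z nz zmin] := @wo_min [set i | ~ Acc (fun j i => below R i j) i].
  by exists i.
apply: nz; constructor => y yz; apply: contrapT => /zmin zy.
by move/negP: yz.
Qed.

Lemma wo_pullback J (f : J -> I) : injective f -> well_order (fun a b => R (f a) (f b)).
Proof.
move=> finj; apply: antisymmetric_well_order.
  by move=> a b /andP[ab ba]; apply: finj; apply: wo_anti.
move=> A [a Aa]; have [|_ [b Ab <-] bmin] := @wo_min (f @` [set a | a \in A]).
  by exists (f a), a.
by exists b; split=> // c Ac; apply: bmin; exists c.
Qed.

End WellOrder.

(** The initial ordinal of a type: if some initial segment of a well-order on
[T] is as large as [T], the least such segment receives [T] injectively, and the
order pulled back along this injection has only smaller segments. *)
Lemma exists_initial_well_order (T : Type) :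
  exists2 R : rel T, well_order R & forall a, ~ ([set: T] #<= below R a).
Proof.
have [R woR] := well_ordering_principle {classic T}.
have [[i iP]|nex] := pselect (exists i, [set: T] #<= below (R : rel T) i); last first.
  by exists R => // a aP; apply: nex; exists a.
have [|m mP mmin] := wo_min woR (P := [set i | [set: T] #<= below (R : rel T) i]).
  by exists i.
have [f fm finj] : exists2 f : T -> T, (forall a, below R m (f a)) & injective f.
  have /card_leP[f] := mP.
  exists (fun x => val (f (SigSub (mem_set (I : [set: T] x))))) => [a|a b /val_inj].
    by rewrite -inE; apply: valP.
  by move=> /(@inj _ _ _ f); rewrite !inE => /(_ I I) [].
exists (fun a b => R (f a) (f b)); first exact: wo_pullback.
move=> a aP; have /negP := fm a; apply; apply: mmin.
apply: card_le_trans aP _.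
apply: (@card_le_trans _ _ _ (f @` below (fun a b => R (f a) (f b)) a)).
  have := @inj_card_eq _ _ (below (fun a b => R (f a) (f b)) a) f.
  by rewrite card_eq_le => /(_ (in2W finj))/andP[].
by apply: subset_card_le => _ [b ba <-].
Qed.

(** * Separating small closed sets from points *)

Lemma card_set_type T (A : set T) : [set: set_type A] #= A.
Proof.
rewrite card_eq_sym.
have AE : A = set_val @` [set: set_type A].
  apply/seteqP; split=> [x Ax|_ [x _ <-]]; last exact: set_valP.
  by exists (SigSub (mem_set Ax)).
by rewrite [X in X #= _]AE; apply: inj_card_eq; apply: in2W; apply: val_inj.
Qed.

Lemma continuum_bigcup_card_le S T (A : set S) (F : S -> set T) :
  A #<= [set: continuum] -> (forall s, A s -> F s #<= [set: continuum]) ->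
  \bigcup_(s in A) F s #<= [set: continuum].
Proof.
move=> /card_le_continuumP[a ainj] Fc.
have /choice[b binj] : forall s, exists b : T -> continuum, A s ->
    forall x y, F s x -> F s y -> b x = b y -> x = y.
  move=> s; have [As|nAs] := pselect (A s); last by exists (fun=> set0).
  by have /card_le_continuumP[b binj] := Fc s As; exists b.
have [->|/set0P[_ [s0 _ _]]] := eqVneq (\bigcup_(s in A) F s) set0.
  exact: card_ge0.
have /choice[h hP] : forall t, exists s, (\bigcup_(s in A) F s) t -> A s /\ F s t.
  move=> t; have [[s As Fst]|nt] := pselect ((\bigcup_(s in A) F s) t).
    by exists s.
  by exists s0.
apply: card_le_trans cle_mul_continuum.
apply: (inj_on_card_le (f := fun t => (a (h t), b (h t) t))) => x y Bx By [].
have [Ahx Fx] := hP x Bx; have [Ahy Fy] := hP y By.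
by move=> /(ainj _ _ Ahx Ahy) e; rewrite -e in Fy *; apply: binj.
Qed.

Section Topology.
Variable X : topologicalType.
Implicit Types (A K Z : set X).

Lemma closureNP A x : ~ closure A x -> exists U, [/\ open U, U x & U `&` A = set0].
Proof.
move=> nAx; exists (~` closure A); split=> //.
- exact/closed_openC/closed_closure.
- by apply/disjoints_subset; apply: subsetC; apply: subset_closure.
Qed.

Lemma discrete_subset_of_isolated A :
  (forall a, A a -> exists U, [/\ open U, U a & forall b, A b -> U b -> b = a]) ->
  discrete_subset A.
Proof.
move=> isol B.
pose inside_B V := open V /\ forall b : set_type A, V (set_val b) -> B b.
exists (\bigcup_(V in inside_B) V).
  by apply: bigcup_open => V [].
apply/seteqP; split=> [b [V [_ VB] Vb]|b Bb]; first exact: VB.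
have [U [oU Ub Ub1]] := isol _ (set_valP b).
exists U => //; split=> // c /(Ub1 _ (set_valP c)) cb.
by rewrite (val_inj cb).
Qed.

(** Shapirovskii's argument: run through [X] along a well-order and put [z] of
[Z] into [D] unless it lies in the closure of the earlier points of [D] or in
the neighbourhood of one of them.  Each [d] in [D] is then isolated from the
earlier points by the first condition and from the later ones by [U d]. *)
Lemma discrete_almost_covering Z (U : X -> set X) :
  (forall z, Z z -> open (U z) /\ U z z) ->
  exists D, [/\ D `<=` Z, discrete_subset D &
    forall z, Z z -> closure D z \/ exists2 d, D d & U d z].
Proof.
move=> oU; have [R woR] := well_ordering_principle {classic X}.
pose Phi z (D : X -> Prop) := [/\ Z z, ~ closure (D `&` below (R : rel X) z) z &
  forall d, D d -> below (R : rel X) z d -> ~ U d z].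
have [|D DE] := @exists_recursive X Prop _ True Phi (wo_wf woR).
  move=> z f g fg.
  have fgE : f `&` below (R : rel X) z = g `&` below (R : rel X) z.
    by apply/seteqP; split=> d [? dz]; split=> //; rewrite (fg, esym (fg d dz)).
  rewrite /Phi fgE; apply/propext; split=> -[Zz nz nU]; split=> // d fd dz.
    by apply: nU => //; rewrite fg.
  by apply: nU => //; rewrite -fg.
exists D; split.
- by move=> d; rewrite DE => -[].
- apply: discrete_subset_of_isolated => a Da; have := Da; rewrite DE => -[Za nca nU].
  have [V [oV Va VD]] := closureNP nca; have [oUa Ua] := oU a Za.
  exists (V `&` U a); split=> //; first exact: openI.
  move=> b Db [Vb Ub]; have := Db; rewrite DE => -[_ _ nUb].
  have [ba|ab] := boolP (R b a); last by case: (nUb a Da ab).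
  have [ab|ab] := boolP (R a b); first exact: wo_anti woR _ _ ba ab.
  by have : (V `&` (D `&` below (R : rel X) a)) b by []; rewrite VD.
- move=> z Zz; have [Dz|nDz] := pselect (D z).
    by left; apply: subset_closure.
  move: nDz; rewrite DE => /not_and3P[//|/contrapT cz|].
    by left; apply: closure_subset cz => d [].
  move=> /existsNP[d /not_implyP[Dd /not_implyP[_ /contrapT Ud]]].
  by right; exists d.
Qed.

Lemma lindelof_closed K (C : set (set X)) : lindelof X -> closed K ->
  C `<=` open -> K `<=` \bigcup_(U in C) U ->
  exists D, [/\ D `<=` C, countable D & K `<=` \bigcup_(U in D) U].
Proof.
move=> lX cK oC KC.
have [|| D [DC cD DX]] := lX ((~` K) |` C).
- by move=> U [->|/oC//]; apply: closed_openC.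
- apply/seteqP; split=> // x _; have [Kx|nKx] := pselect (K x).
    by have [U CU Ux] := KC x Kx; exists U => //; right.
  by exists (~` K) => //; left.
exists (D `&` C); split; first by move=> U [].
  by apply: sub_countable cD; apply: subset_card_le => U [].
move=> x Kx; have : (\bigcup_(U in D) U) x by rewrite DX.
move=> [U DU Ux]; exists U => //; split=> //.
by have [UK|//] := DC U DU; rewrite UK in Ux.
Qed.

(** For [K] closed, this bounds the pseudocharacter of [K] in [X] by the
continuum. *)
Definition separated_by_continuum K :=
  exists V : set (set X), [/\ V #<= [set: continuum],
    forall U, V U -> open U /\ K `<=` U
    & forall p, ~ K p -> exists2 U, V U & ~ U p].

(** Closures of the members of a cover of the complement of [x] by open sets
remote from [x] have complements that are neighbourhoods of [x] separating it
from everything; a cover indexed by the closure of a discrete set is small. *)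
Lemma point_separated x : hausdorff_space X ->
  (forall D : set X, discrete_subset D -> closure D #<= [set: continuum]) ->
  separated_by_continuum [set x].
Proof.
move=> hX cD.
have /choice[U UP] : forall z, exists U : set X,
    z <> x -> [/\ open U, U z & ~ closure U x].
  move=> z; have [->|/eqP zx] := pselect (z = x); first by exists setT.
  move: hX; rewrite open_hausdorff => /(_ z x zx)[[A B]/=].
  rewrite !inE => -[Az Bx] [oA oB AB0]; exists A => _; split=> //.
  have : closed (~` B) by apply: open_closedC.
  rewrite closure_id => BE; have AB : A `<=` ~` B by apply/disjoints_subset.
  by move=> /(closure_subset AB); rewrite -BE => nBx; apply: nBx.
have [|D [Dx dD DP]] := @discrete_almost_covering (~` [set x]) U.
  by move=> z /UP[].
exists ((fun z => ~` closure (U z)) @` (closure D `\ x)); split.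
- apply: card_le_trans (card_image_le _ _) _.
  by apply: card_le_trans (cD D dD); apply: subset_card_le => z [].
- move=> _ [z [_ zx] <-]; have [_ _ nx] := UP z zx; split; last by move=> _ ->.
  exact/closed_openC/closed_closure.
- move=> p px; have [cp|[d Dd Udp]] := DP p px.
    exists (~` closure (U p)); first by exists p.
    by apply; apply: subset_closure; have [] := UP p px.
  exists (~` closure (U d)); last by apply; apply: subset_closure.
  by exists d => //; split; [apply: subset_closure|apply: Dx].
Qed.

(** For fixed [p] outside [K], the neighbourhoods of points of [K] that miss [p]
cover [K]; a countable subcover has a union that contains [K] and misses [p].
All the neighbourhoods together number at most the continuum, hence so do their
countable unions. *)
Lemma closed_separated K : lindelof X ->
  (forall x, separated_by_continuum [set x]) ->
  closed K -> K #<= [set: continuum] -> separated_by_continuum K.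
Proof.
move=> lX /choice[V VP] cK Kc.
have [->|/set0P[y0 Ky0]] := eqVneq K set0.
  exists [set set0]; split.
  - by apply: (inj_on_card_le (f := fun=> set0)) => A B -> ->.
  - by move=> _ ->; split; [exact: open0|].
  - by move=> p _; exists set0.
pose B := \bigcup_(y in K) V y.
have Bc : B #<= [set: continuum].
  by apply: continuum_bigcup_card_le => // y _; have [] := VP y.
have [b binj] := (card_le_continuumP B).1 Bc.
(* [W f] is the union of the neighbourhoods whose code is listed by [f]; a
   countable family is listed by [f] only if nonempty, whence the separate case
   of an empty [K]. *)
pose W (f : nat -> continuum) := \bigcup_(U in [set U | B U /\ exists n, b U = f n]) U.
exists [set U | K `<=` U /\ exists f, U = W f]; split.
- apply: (@card_le_trans _ _ _ [set W f | f in [set: nat -> continuum]]).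
    by apply: subset_card_le => U [_ [f ->]]; exists f.
  exact: card_le_trans (card_image_le _ _) cle_fun_continuum.
- move=> U [KU [f UE]]; split=> //; rewrite UE; apply: bigcup_open => A [[y _ VyA] _].
  by have [_ /(_ A VyA)[]] := VP y.
- move=> p nKp.
  have [||D [DC cD KD]] := @lindelof_closed K [set U | B U /\ ~ U p] lX cK.
  + by move=> A [[y _ VyA] _]; have [_ /(_ A VyA)[]] := VP y.
  + move=> y Ky; have [_ Vy /(_ p)[py|A VA nAp]] := VP y.
      by apply: nKp; rewrite py.
    exists A; first by split=> //; exists y.
    by have [_] := Vy A VA; apply.
  have [U0 DU0 _] := KD y0 Ky0.
  have [D0|[g]] := pfcard_geP cD; first by rewrite D0 in DU0.
  have gP n : D (g n) by apply: funS.
  exists (W (b \o g)).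
    split; last by exists (b \o g).
    move=> y /KD[A DA Ay]; exists A => //; split; first by have [] := DC A DA.
    by have [n _ <-] := 'surj_g DA; exists n.
  move=> [A [BA [n /= bn]] Ap].
  have [Bg ngp] := DC _ (gP n).
  by apply: ngp; rewrite -(binj _ _ BA Bg bn).
Qed.

(** * Free sequences *)

Lemma open_disjoint_closure (V B : set X) : open V -> V `&` B = set0 ->
  V `&` closure B = set0.
Proof.
move=> oV; rewrite setIC => /disjoints_subset BV; rewrite setIC.
apply/disjoints_subset; have /closure_id -> := open_closedC oV.
exact: closure_subset.
Qed.

Section Covers.
Variables (I : Type) (R : rel I) (x : I -> X) (V : I -> set X).
Hypothesis woR : well_order R.

(** If there are terms after [c], let [d] be the first one: [V d] contains the
closure of the terms up to [c], and all terms after [c] avoid it. *)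
Lemma free_sequence_of_covers :
  (forall i, open (V i) /\ closure (x @` below R i) `<=` V i) ->
  (forall i j, R i j -> ~ V i (x j)) ->
  free_sequence R x.
Proof.
move=> VP Vx c.
have [[d0 cd0]|nd] := pselect ([set a | ~~ R a c] !=set0); last first.
  have -> : [set a | ~~ R a c] = set0.
    by apply/seteqP; split=> // a ac; case: nd; exists a.
  by rewrite image_set0 closure0 setI0.
have [|d /negP cd dmin] := wo_min woR (P := [set a | ~~ R a c]); first by exists d0.
have [oV Vd] := VP d.
have V0 : V d `&` closure (x @` [set a | ~~ R a c]) = set0.
  apply: open_disjoint_closure => //; apply/seteqP; split=> // y [Vy [a ca xa]].
  by rewrite -xa in Vy; apply: Vx Vy; apply: dmin.
apply/seteqP; split=> // y [cly cry]; rewrite -V0; split=> //.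
apply/Vd/(closure_subset _ cly); apply: image_subset => a /= ac.
by apply/negP => da; apply: cd; apply: wo_trans ac.
Qed.

(** The term at [a] is cut off from the later ones by [V d], where [d] is the
next index, and from the earlier ones because [V a] contains their closure but
not the term.  Freeness alone would not suffice for the second half: in the
sense used here, an injective convergent sequence followed by its limit is free
when the space is Hausdorff. *)
Lemma discrete_subset_of_covers i :
  (forall j, below R i j -> open (V j) /\ closure (x @` below R j) `<=` V j) ->
  (forall j a, below R i a -> R j a -> ~ V j (x a)) ->
  discrete_subset (x @` below R i).
Proof.
move=> VP Vx; apply: discrete_subset_of_isolated => _ [a ai <-].
(* The index [a] may be the last one below [i], and then [setT] will do. *)
have [W [oW Wa Wb]] : exists W, [/\ open W, W (x a) &
    forall b, below R i b -> below R b a -> ~ W (x b)].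
  have [[d0 d0P]|nd] := pselect ([set d | below R i d /\ below R d a] !=set0); last first.
    by exists setT; split=> // [|b bi ab]; [exact: openT|case: nd; exists b].
  have [|d [di ad] dmin] := wo_min woR (P := [set d | below R i d /\ below R d a]).
    by exists d0.
  have [oV Vd] := VP d di; exists (V d); split=> // [|b bi ab].
    by apply/Vd/subset_closure; exists a.
  by apply: Vx => //; apply: dmin.
exists (W `&` ~` closure (x @` below R a)); split.
- by apply: openI => //; exact/closed_openC/closed_closure.
- split=> // cla; apply: (Vx a a ai (wo_refl woR a)).
  by have [_] := VP a ai; apply.
- move=> _ [b bi <-] [Wxb nb].
  have [ba|ba] := boolP (R a b); last by case: nb; apply: subset_closure; exists b.
  have [ab|ab] := boolP (R b a); first by rewrite (wo_anti woR ba ab).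
  by case: (Wb b bi ab).
Qed.

End Covers.

Lemma free_sequence_inj (I : Type) (R : rel I) (x : I -> X) :
  well_order R -> free_sequence R x -> injective x.
Proof.
move=> woR fx.
have sep a b : R a b -> x a = x b -> a = b.
  move=> ab xab; have [ba|ba] := boolP (R b a); first exact: wo_anti woR _ _ ab ba.
  have [] : set0 (x a); rewrite -(fx a); split.
    by apply: subset_closure; exists a => //=; apply: wo_refl.
  by apply: subset_closure; exists b.
move=> a b xab; have [ab|ba] := wo_total woR a b; first exact: sep.
by apply/esym/sep.
Qed.

(** The length of a free sequence can be cut down to any smaller cardinal by
pulling the well-order back along an injection. *)
Lemma Fhat_no_free_sequence (F L : cardinal) (R : rel L) (x : L -> X) :
  is_Fhat X F -> cle F L -> well_order R -> ~ free_sequence R x.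
Proof.
move=> [nfree _] /cleP[f finj] woR fx.
apply: (nfree (range (x \o f))).
  apply: inj_card_eq; apply: in2W; apply: inj_comp finj.
  exact: free_sequence_inj fx.
exists F, (fun a b => R (f a) (f b)), (x \o f); split=> //.
  exact: wo_pullback.
move=> c; apply/seteqP; split=> // y [ly ry]; rewrite -(fx (f c)); split.
  by apply: closure_subset ly => _ [a ac <-]; exists (f a).
by apply: closure_subset ry => _ [a ac <-]; exists (f a).
Qed.

(** The separating set attached to a point, paired with a code for it among
continuum many: the code is what gets counted. *)
Lemma coded_separation K : separated_by_continuum K ->
  exists w : (X -> set X) * (X -> continuum),
    (forall p, ~ K p -> [/\ open (w.1 p), K `<=` w.1 p & ~ w.1 p p]) /\
    (forall p q, ~ K p -> ~ K q -> w.2 p = w.2 q -> w.1 p = w.1 q).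
Proof.
move=> [V [/card_le_continuumP[b binj] VP VK]].
have /choice[w wP] : forall p, exists U, ~ K p -> V U /\ ~ U p.
  move=> p; have [Kp|/VK[U VU Up]] := pselect (K p); first by exists set0.
  by exists U.
exists (w, b \o w); split=> /= [p /wP[Vw nw]|p q /wP[Vp _] /wP[Vq _]].
  by have [] := VP _ Vw.
exact: binj.
Qed.

(** * Counting the points *)

(** Each point is caught in the closure of an initial segment of a sequence that
is coded by fewer than continuum many choices out of continuum many. *)
Lemma cle_continuum_of_separated (p0 : X) :
  is_cexp2_lt continuum continuum ->
  (forall D : set X, discrete_subset D -> closure D #<= [set: continuum]) ->
  (forall K, closed K -> K #<= [set: continuum] -> separated_by_continuum K) ->
  (forall (R : rel continuum) (x : continuum -> X),
     well_order R -> ~ free_sequence R x) ->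
  cle X continuum.
Proof.
move=> powc dc sepc nofree.
have [R woR Rinit] := exists_initial_well_order continuum.
have /choice[w wP] : forall S : set X, exists w : (X -> set X) * (X -> continuum),
    closure S #<= [set: continuum] ->
    (forall p, ~ closure S p ->
      [/\ open (w.1 p), closure S `<=` w.1 p & ~ w.1 p p]) /\
    (forall p q, ~ closure S p -> ~ closure S q ->
      w.2 p = w.2 q -> w.1 p = w.1 q).
  move=> S.
  have [Sc|nSc] := pselect (closure S #<= [set: continuum]).
    have [w wP] := coded_separation (sepc _ (@closed_closure _ S) Sc).
    by exists w.
  by exists ((fun=> set0), (fun=> set0)).
(* The new term depends only on the union to be avoided, not on [p], so that
   two points making the same choices build the same sequence. *)
have /choice[phi phiP] : forall O : set X, exists y, forall p, ~ O p -> ~ O y.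
  move=> O; have [->|/eqP OT] := eqVneq O setT.
    by exists p0 => p; case.
  have [y Oy] : exists y, ~ O y.
    by apply/existsNP => allO; apply: OT; apply/seteqP; split.
  by exists y.
have /choice[x xP] : forall p, exists x : continuum -> X, forall i,
    x i = phi (\bigcup_(j in [set j | R j i]) (w (x @` below R j)).1 p).
  move=> p; apply: (exists_recursive p0 (wo_wf woR)) => i f g fg.
  congr phi; apply: eq_bigcupr => j /= ji; congr ((w _).1 p).
  by apply: eq_imagel => k kj; apply/fg/(subset_below woR ji).
(* [S p i] is the set of terms before [i], and [good p i] says that [p] has not
   been caught by the closure of an initial segment strictly before [i]. *)
pose S p i := x p @` below R i.
pose good p i := forall j, below R i j -> ~ closure (S p j) p.
have goodW p i j : good p i -> R j i -> good p j.
  move=> gi ji k kj; apply: gi; exact: (subset_below woR ji kj).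
(* The separating sets used so far all miss [p], so their union is proper and
   the next term does avoid it. *)
have avoid p i : good p i ->
    (forall j, below R i j -> closure (S p j) #<= [set: continuum]) ->
  forall j a, below R i a -> R j a -> ~ (w (S p j)).1 p (x p a).
  move=> gi ci j a ai ja wa.
  have : ~ (\bigcup_(k in [set k | R k a]) (w (S p k)).1 p) p.
    move=> [k /= ka]; have ki := below_trans woR ka ai.
    by have [/(_ p (gi k ki))[]] := wP _ (ci k ki).
  by move/phiP; rewrite -xP; apply; exists j.
have small p i : good p i -> closure (S p i) #<= [set: continuum].
  have := @well_founded_induction _ _ (wo_wf woR)
    (fun i => good p i -> closure (S p i) #<= [set: continuum]); apply.
  move=> {}i IH gi; have ci j : below R i j -> closure (S p j) #<= [set: continuum].
    by move=> ji; apply: IH => //; apply: goodW gi (belowW woR ji).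
  apply: dc; apply: (discrete_subset_of_covers (V := fun j => (w (S p j)).1 p) woR).
    by move=> j ji; have [/(_ p (gi j ji))[]] := wP _ (ci j ji).
  exact: avoid.
(* If [p] were never caught, its sequence would be free of full length. *)
have /choice[i iP] : forall p, exists i, good p i /\ closure (S p i) p.
  move=> p; apply: contrapT => /forallNP ni.
  have gp i : good p i.
    have := @well_founded_induction _ _ (wo_wf woR) (good p); apply.
    by move=> {}i IH j ji cj; apply: (ni j); split=> //; apply: IH.
  have ncl j : ~ closure (S p j) p by move=> cj; apply: (ni j).
  apply: (nofree R (x p) woR).
  apply: (free_sequence_of_covers (V := fun j => (w (S p j)).1 p) woR).
    by move=> j; have [/(_ p (ncl j))[]] := wP _ (small p j (gp j)).
  move=> k j kj wk.
  have : ~ (\bigcup_(k in [set k | R k j]) (w (S p k)).1 p) p.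
    move=> [l _]; by have [/(_ p (ncl l))[]] := wP _ (small p l (gp l)).
  by move/phiP; rewrite -xP; apply; exists k.
(* [h k] codes the restriction of a function to the indices before [k]; this is
   where fewer than continuum many choices become a single one. *)
have /choice[h hP] : forall k, exists h : (continuum -> continuum) -> continuum,
    forall s t, h s = h t -> forall j, below R k j -> s j = t j.
  move=> k; have : clt (set_type (below R k)) continuum.
    split; first by apply/cleP; exists set_val; apply: val_inj.
    move=> ck; apply: (Rinit k); apply: card_le_trans ck _.
    by have := card_set_type (below R k); rewrite card_eq_le => /andP[].
  move=> /(cle_pow_continuum powc)/cleP[g ginj].
  exists (fun s => g (s \o set_val)) => s t /ginj st j ji.
  exact: (congr1 (@^~ (SigSub (mem_set ji))) st).
have /choice[e eP] : forall A : set X, exists e : X -> continuum,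
    A #<= [set: continuum] -> forall p q, A p -> A q -> e p = e q -> p = q.
  move=> A; have [/card_le_continuumP[e eA]|nA] := pselect (A #<= [set: continuum]).
    by exists e.
  by exists (fun=> set0).
apply: (@cle_trans _ (cmul (cmul continuum continuum) continuum)); last first.
  apply: cle_trans cle_mul_continuum; have /cleP[m minj] := cle_mul_continuum.
  by apply/cleP; exists (fun t => (m t.1, t.2)) => -[a b] [c d] [/minj -> ->].
apply/cleP.
exists (fun p => (i p, h (i p) (fun j => (w (S p j)).2 p), e (closure (S p (i p))) p)).
move=> p q [ipq]; have [gp cp] := iP p; have [gq cq] := iP q.
rewrite -ipq in gq cq *; move=> /hP codes.
(* Equal choices before [i p] give equal initial segments, by induction. *)
have Spq j : R j (i p) -> S p j = S q j.
  have := @well_founded_induction _ _ (wo_wf woR)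
    (fun j => R j (i p) -> S p j = S q j); apply.
  move=> {}j IH ji; apply: eq_imagel => k kj.
  rewrite !xP; congr phi; apply: eq_bigcupr => l /= lk.
  have lj := below_trans woR lk kj.
  have li : below R (i p) l by exact: (subset_below woR ji lj).
  have SE := IH l lj (belowW woR li); rewrite -/(S p l) -/(S q l).
  have := codes l li; rewrite -SE.
  have [_ wE] := wP _ (small p l (goodW _ _ _ gp (belowW woR li))).
  apply: wE; first exact: gp.
  rewrite SE; exact: gq.
rewrite -(Spq _ (wo_refl woR _)) in cq *; apply: eP => //.
exact: small.
Qed.
End Topology.

Theorem corollary3p10
  (pow_lt_c : is_cexp2_lt continuum continuum)
  (X : topologicalType) (hausdorffX : hausdorff_space X)
  (lindelofX : lindelof X)
  (F G : cardinal) (FhatX : is_Fhat X F) (gX : is_g X G)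
  (FG_le_c : cle (cmul F G) continuum) :
  cle X continuum.
Proof.
have [[p0 _]|nX] := pselect ([set: X] !=set0); last first.
  by apply/cleP; exists (fun=> set0) => p; case: nX; exists p.
(* An empty factor would make the product empty and its bound on the other
   factor void, so points of [F] and [G] are exhibited first. *)
have [g0] : $|G|.
  have /cleP[g _] : cle (set_type (closure [set p0])) G.
    apply: gX.1; exists [set p0] => //; apply: discrete_subset_of_isolated => _ ->.
    by exists setT; split=> //; exact: openT.
  exact: squash (g (SigSub (mem_set (subset_closure (erefl p0))))).
have [f0] : $|F|.
  apply: contrapT => noF; apply: (FhatX.1 set0).
    by rewrite card_eq_sym card_eq0; apply/eqP/seteqP; split=> // f _; apply: noF.
  exists void, (fun _ _ => true), (fun v : void => match v with end); split.
  - by move=> A [[]].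
  - by case.
  - by apply/seteqP; split=> // x [[]].
have /cleP[m minj] := FG_le_c.
have Fc : cle F continuum.
  by apply/cleP; exists (fun f => m (f, g0)) => f f' /minj[].
have Gc : cle G continuum.
  by apply/cleP; exists (fun g => m (f0, g)) => g g' /minj[].
have dc (D : set X) : discrete_subset D -> closure D #<= [set: continuum].
  move=> dD; apply: (@card_le_trans _ _ _ [set: set_type (closure D)]).
    by have := card_set_type (closure D); rewrite card_eq_le => /andP[].
  by apply: cle_trans Gc; apply: gX.1; exists D.
apply: (cle_continuum_of_separated p0) => //.
- move=> K; apply: closed_separated => // x.
  exact: point_separated.
- move=> R x; exact: Fhat_no_free_sequence Fc.
Qed.
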